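(* Let $M\subset M'$ be rich dense sub-semigroups of $\mathcal{M}$. Suppose that $\Phi\colon M'\to\mathcal{M}$ is multiplicative and degree-preserving, that $\Phi[p]\in\mathcal{P}$ for every $p\in M'\cap\mathcal{P}$, and that the restriction of $\Phi$ to $M$ is the identity map. Then $\Phi$ is the identity map, i.e. $\Phi[p]=p$ for all $p\in M'$.
   Context: $\mathcal{M}$ is the set of real polynomials $p(x)=\sum_{k=0}^d p_kx^k$ in one variable (of arbitrary degree) with $p(x)>0$ for all $x>0$ and $p(1)=1$; it is a semigroup under multiplication. $\mathcal{P}\subset\mathcal{M}$ is the set of real polynomials with non-negative coefficients and $p(1)=1$. $\mathcal{M}$ is endowed with the topology of simultaneous convergence of the coefficients and the degree: $p^{(t)}\to p$ iff $\deg(p^{(t)})\to\deg(p)$ and $p^{(t)}_k\to p_k$ for all $k$ (equivalently, $\mathcal{M}$ is the topological disjoint union over $d$ of its subsets of polynomials of degree exactly $d$, each with the Euclidean topology on coefficient vectors). Dense means dense in $\mathcal{M}$ in this topology; a sub-semigroup is a subset closed under multiplication. A set $P$ of polynomials is rich if $P$ contains the polynomial $x$ and, whenever $P$ contains a polynomial of the form $x^m\cdot r(x)$, it also contains $r(x)$. $\Phi$ is multiplicative if $\Phi[p\cdot q]=\Phi[p]\cdot\Phi[q]$ for all $p,q\in M'$, and degree-preserving if $\deg(\Phi[q])=\deg(q)$ for all $q\in M'$. *)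

(* Defs.v *)
From HB Require Import structures.
From mathcomp Require Import all_boot all_order all_algebra.
From mathcomp Require Import all_classical all_reals all_analysis.

Set Implicit Arguments.
Unset Strict Implicit.
Unset Printing Implicit Defensive.

Import Order.TTheory GRing.Theory Num.Theory.
Import numFieldNormedType.Exports.

Local Open Scope classical_set_scope.
Local Open Scope ring_scope.

(* The zero polynomial also gets degree 0; it lies in neither calM nor calP. *)
Definition deg (R : realType) (p : {poly R}) : nat := (size p).-1.

Definition calM (R : realType) : set {poly R} :=
  [set p : {poly R} | (forall x : R, 0 < x -> 0 < p.[x]) /\ p.[1] = 1].

Definition calP (R : realType) : set {poly R} :=
  [set p : {poly R} | (forall k : nat, 0 <= p`_k) /\ p.[1] = 1].

Definition deg_coefs (R : realType) (p : {poly R}) : nat * {ptws nat -> R} :=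
  (deg p, fun k : nat => p`_k).

(* Topology of simultaneous convergence of the degree (in the discrete space
   nat) and of every coefficient; see poly_cvgP. *)
Definition poly_top (R : realType) : topologicalType :=
  initial_topology (@deg_coefs R).

Lemma poly_cvgP (R : realType) (u : nat -> {poly R}) (p : {poly R}) :
  ((u : nat -> poly_top R) @ \oo --> (p : poly_top R)) <->
  (deg (u t) @[t --> \oo] --> deg p /\
   forall k : nat, (u t)`_k @[t --> \oo] --> p`_k).
Proof.
split.
- move=> up.
  have h : deg_coefs (u t) @[t --> \oo] --> deg_coefs p.
    move=> V Vp; apply: (up (@deg_coefs R @^-1` V)).
    exact: (@initial_continuous _ _ (@deg_coefs R) p V Vp).
  have c1 : continuous (fst : nat * {ptws nat -> R} -> nat).
    by move=> x; exact: cvg_fst.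
  have c2 : continuous (snd : nat * {ptws nat -> R} -> {ptws nat -> R}).
    by move=> x; exact: cvg_snd.
  split=> [V Vp|k V Vp].
    exact: (h (fst @^-1` V) (c1 (deg_coefs p) V Vp)).
  apply: (h (snd @^-1` (@proj nat (fun=> R) k @^-1` V))).
  apply: (c2 (deg_coefs p)).
  exact: (@proj_continuous _ (fun=> R) k _ V Vp).
- move=> [ud uk] U; rewrite nbhsE => -[B [[A oA <-] Ap] BU].
  apply: (filterS BU).
  have hk : (fun t => (fun k => (u t)`_k) : {ptws nat -> R}) @ \oo -->
            ((fun k => p`_k) : {ptws nat -> R}).
    apply/cvg_sup => k V [W [[C oC <-] Cp] WV]; apply: (filterS WV).
    by apply: (uk k); exact: open_nbhs_nbhs.
  have h : deg_coefs (u t) @[t --> \oo] --> deg_coefs p.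
    move=> V [[Q S] [/ud Qp /hk Sp] QSV].
    rewrite nbhs_simpl /= in Qp Sp *.
    by near=> t; apply: QSV; split; near: t.
  exact: (h A (open_nbhs_nbhs (conj oA Ap))).
Unshelve. all: by end_near.
Qed.

(* set_type carries the subspace topology, so this is density in calM. *)
Definition dense_in_calM (R : realType) (P : set {poly R}) :=
  dense (set_val @^-1` P : set (set_type (@calM R : set (poly_top R)))).

Definition sub_semigroup (R : realType) (P : set {poly R}) :=
  P `<=` @calM R /\ forall p q : {poly R}, P p -> P q -> P (p * q).

Definition rich (R : realType) (P : set {poly R}) :=
  P 'X /\ forall (m : nat) (r : {poly R}), P ('X^m * r) -> P r.

Definition multiplicative_on (R : realType) (M' : set {poly R})
    (Phi : {poly R} -> {poly R}) :=
  forall p q : {poly R}, M' p -> M' q -> Phi (p * q) = Phi p * Phi q.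

Definition degree_preserving_on (R : realType) (M' : set {poly R})
    (Phi : {poly R} -> {poly R}) :=
  forall q : {poly R}, M' q -> deg (Phi q) = deg q.

(* Main.v *)
Require Import Defs.
From mathcomp Require Import all_boot all_order all_algebra.
From mathcomp Require Import all_classical all_reals all_analysis.
From mathcomp Require Import ring lra zify.

(* Dividing by powers of x, assume f(0) <> 0 and put g = Phi f. If h in M is such
   that f h has nonnegative coefficients, then so has g h = Phi (f h). By density
   and a small perturbation this extends to every real polynomial h with
   f h >= 0 coefficientwise. By Polya's theorem F = f (1 + x)^N has positive
   coefficients for large N, and G = g (1 + x)^N inherits the implication. Taking
   for h a truncation of the power series 1 / F, corrected in high degree to make
   F h nonnegative, shows that the power series G / F has nonnegative
   coefficients l_n. For n > deg G this gives F_0 l_n <= G_n = 0, so G / F is a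
   polynomial, and it is constant because deg G = deg F. *)

Set Implicit Arguments.
Unset Strict Implicit.
Unset Printing Implicit Defensive.

Import Order.TTheory GRing.Theory Num.Theory.
Import numFieldNormedType.Exports.

Local Open Scope classical_set_scope.
Local Open Scope ring_scope.

(** * Coefficients of products with powers of [1 + 'X], and falling factorials *)

Lemma coef_expr1DX (R : nzRingType) (n k : nat) :
  ((1 + 'X : {poly R}) ^+ n)`_k = 'C(n, k)%:R.
Proof.
have -> : (1 + 'X : {poly R}) ^+ n = \poly_(i < n.+1) 'C(n, i)%:R.
  rewrite exprDn_comm; last exact: commr_sym (commr1 _).
  rewrite poly_def; apply: eq_bigr => i _.
  by rewrite expr1n mul1r scaler_nat.
rewrite coef_poly ltnS; case: leqP => // kn.
by rewrite bin_small.
Qed.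

Lemma size_expr1DX (R : idomainType) (n : nat) :
  size ((1 + 'X : {poly R}) ^+ n) = n.+1.
Proof. by rewrite addrC -[1]opprK -polyCN size_exp_XsubC. Qed.

Lemma binB_ffact (n d j k : nat) : (j <= d -> j <= k -> k <= n + d ->
  'C(n, k - j) * (k`! * (n + d - k)`!) =
  n`! * (k ^_ j * (n + d - k) ^_ (d - j)))%N.
Proof.
(* If [k - j] exceeds [n], the binomial and the second falling factorial both vanish; otherwise both
   sides expand into factorials. *)
move=> jd jk kn; have [kjn|nkj] := leqP (k - j) n; last first.
  by rewrite bin_small// [(n + d - k) ^_ _]ffact_small ?muln0//; lia.
have djm : (d - j <= n + d - k)%N by lia.
rewrite -(ffact_fact jk) -(ffact_fact djm) -(bin_fact kjn).
have -> : (n + d - k - (d - j) = n - (k - j))%N by lia.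
lia.
Qed.

(** The sum on the right is the degree-[d] homogenization of [f] at [(k, n + d - k)] with powers
    replaced by falling factorials. The other factors are positive, so this sum decides the sign of
    the coefficient. *)
Lemma coefM_expr1DX (R : comNzRingType) (f : {poly R}) (n d k : nat) :
  (size f <= d.+1)%N -> (k <= n + d)%N ->
  (f * (1 + 'X) ^+ n)`_k * (k`! * (n + d - k)`!)%:R =
  n`!%:R * \sum_(j < d.+1) f`_j * (k ^_ j * (n + d - k) ^_ (d - j))%:R.
Proof.
move=> sf knd; have fE : f = \sum_(j < d.+1) f`_j *: 'X^j.
  apply/polyP => i; rewrite -(poly_def d.+1 (fun i => f`_i)) coef_poly.
  by case: ltnP => // di; rewrite nth_default// (leq_trans sf di).
rewrite {1}fE mulr_suml coef_sum mulr_suml mulr_sumr; apply: eq_bigr => j _.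
rewrite -scalerAl coefZ coefXnM coef_expr1DX.
rewrite -mulrA [RHS]mulrCA; congr (_ * _); have [kj|jk] := ltnP k j.
  by rewrite mul0r ffact_small// mul0n mulr0.
by rewrite -!natrM binB_ffact// -ltnS ltn_ord.
Qed.

Lemma leq_ffact_expn (k j : nat) : (k ^_ j <= k ^ j)%N.
Proof.
by elim: j => // j IH; rewrite ffactnSr expnSr leq_mul// leq_subr.
Qed.

Lemma ffact_expr_le1 (R : realFieldType) (m k j : nat) :
  (0 < m)%N -> (k <= m)%N -> 0 <= ((k ^_ j)%:R / m%:R ^+ j : R) <= 1.
Proof.
move=> m0 km; rewrite divr_ge0 ?exprn_ge0//= ler_pdivrMr ?exprn_gt0 ?ltr0n//.
rewrite mul1r -natrX ler_nat (leq_trans (leq_ffact_expn k j))//.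
by case: j => // i; rewrite leq_exp2r.
Qed.

(** The bound is uniform in [k], which lets [polya] choose one threshold for all coefficients. *)
Lemma ffact_expr_dist (R : realFieldType) (m k j : nat) :
  (0 < m)%N -> (k <= m)%N ->
  `|(k ^_ j)%:R / m%:R ^+ j - (k%:R / m%:R) ^+ j| <= (j ^ 2)%:R / m%:R :> R.
Proof.
move=> m0 km; have m0' : 0 < m%:R :> R by rewrite ltr0n.
have km1 : k%:R / m%:R <= 1 :> R by rewrite ler_pdivrMr// mul1r ler_nat.
elim: j => [|j IH]; first by rewrite !expr0 divr1 subrr normr0 mul0r.
(* The truncated [k - j] may become a true difference: when [k < j] the factor [k ^_ j] is already
   zero. *)
have -> : (k ^_ j.+1)%:R = (k ^_ j)%:R * (k%:R - j%:R) :> R.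
  rewrite ffactnSr natrM; have [jk|kj] := leqP j k; first by rewrite natrB.
  by rewrite ffact_small// !mul0r.
have -> : (k ^_ j)%:R * (k%:R - j%:R) / m%:R ^+ j.+1 - (k%:R / m%:R) ^+ j.+1 =
  ((k ^_ j)%:R / m%:R ^+ j - (k%:R / m%:R) ^+ j) * (k%:R / m%:R)
  - j%:R / m%:R * ((k ^_ j)%:R / m%:R ^+ j) :> R.
  rewrite exprSr invfM [(_ / _) ^+ j.+1]exprSr; ring.
have a0 i : 0 <= i%:R / m%:R :> R by rewrite divr_ge0.
have /andP[b0 ff1] := @ffact_expr_le1 R m k j m0 km.
apply: (le_trans (ler_normB _ _)); rewrite !(normrM (_ - _)) (normrM (j%:R / _)).
rewrite (ger0_norm (a0 k)) (ger0_norm (a0 j)) (ger0_norm b0).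
apply: (@le_trans _ _ ((j ^ 2)%:R / m%:R + j%:R / m%:R)).
  apply: lerD; last by rewrite ler_piMr.
  by rewrite (le_trans _ IH)// ler_piMr.
by rewrite -mulrDl ler_pM2r ?invr_gt0// -natrD ler_nat; lia.
Qed.

(** * Positivity on a segment and Polya's theorem *)

Lemma horner_endpoints_ge0 (R : rcfType) (p : {poly R}) (a b : R) : a < b ->
  (forall x : R, a < x < b -> 0 < p.[x]) -> 0 <= p.[a] /\ 0 <= p.[b].
Proof.
move=> ab pab; pose c := (a + b) / 2.
have [ac cb] : a < c /\ c < b by rewrite /c; split; lra.
have pc : 0 < p.[c] by apply: pab; rewrite ac.
split; rewrite leNgt; apply/negP => p0.
- have [||x /andP[ax xc] /rootP px] := @poly_ivt R p a c; first exact: ltW.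
    by rewrite !ltW.
  move: ax; rewrite le_eqVlt => /predU1P[ax|ax].
    by move: p0; rewrite ax px ltxx.
  by have := pab x; rewrite ax (le_lt_trans xc cb) px ltxx => /(_ isT).
- have [||x /andP[cx xb] /rootP px] := @poly_ivt R (- p) c b; first exact: ltW.
    by rewrite !hornerN oppr_le0 oppr_ge0 !ltW.
  move: px; rewrite hornerN => /eqP; rewrite oppr_eq0 => /eqP px.
  move: xb; rewrite le_eqVlt => /predU1P[xb|xb].
    by move: p0; rewrite -xb px ltxx.
  by have := pab x; rewrite xb (lt_le_trans ac cx) px ltxx => /(_ isT).
Qed.

Lemma continuous_gt0_lbound (R : realType) (f : R -> R) (a b : R) : a <= b ->
  continuous f -> (forall x, a <= x <= b -> 0 < f x) ->
  exists2 e, 0 < e & forall x, a <= x <= b -> e <= f x.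
Proof.
move=> ab cf f0.
have [c cab fc] := EVT_min ab (continuous_subspaceT cf).
by exists (f c) => [|x xab]; [exact: f0|exact: fc].
Qed.

(* Homogenizing to degree d turns positivity on the open half line into
   positivity on the compact segment x + y = 1. *)
Definition homog_poly (R : nzRingType) (d : nat) (f : {poly R}) : {poly R} :=
  \sum_(j < d.+1) f`_j *: ('X^j * (1 - 'X) ^+ (d - j)).

Lemma horner_homog (R : comNzRingType) (d : nat) (f : {poly R}) (x : R) :
  (homog_poly d f).[x] = \sum_(j < d.+1) f`_j * (x ^+ j * (1 - x) ^+ (d - j)).
Proof.
rewrite horner_sum; apply: eq_bigr => j _.
by rewrite hornerZ hornerM hornerXn horner_exp !hornerE.
Qed.

Lemma homog_gt0 (R : rcfType) (f : {poly R}) :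
  f`_0 != 0 -> (forall x : R, 0 < x -> 0 < f.[x]) ->
  forall x : R, 0 <= x <= 1 -> 0 < (homog_poly (size f).-1 f).[x].
Proof.
move=> f00 fpos; set d := (size f).-1; set F := homog_poly d f.
have fn0 : f != 0 by apply: contra_neq f00 => ->; rewrite coef0.
have sf : size f = d.+1 by rewrite /d prednK// size_poly_gt0.
have F01 x : 0 < x < 1 -> 0 < F.[x].
  move=> /andP[x0 x1]; have x1' : 0 < 1 - x by rewrite subr_gt0.
  suff -> : F.[x] = (1 - x) ^+ d * f.[x / (1 - x)].
    by rewrite mulr_gt0 ?exprn_gt0// fpos// divr_gt0.
  rewrite horner_homog horner_coef sf mulr_sumr; apply: eq_bigr => j _.
  have jd : (j <= d)%N by rewrite -ltnS.
  rewrite [RHS]mulrCA; congr (_ * _).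
  have -> : (1 - x) ^+ d = (1 - x) ^+ (d - j) * (1 - x) ^+ j.
    by rewrite -exprD subnK.
  rewrite expr_div_n mulrC -mulrA; congr (_ * _).
  by rewrite mulrC divfK// expf_neq0// gt_eqF.
have F0 : F.[0] = f`_0.
  rewrite horner_homog big_ord_recl big1/= => [|i _].
    by rewrite subr0 expr1n !mulr1 addr0.
  by rewrite exprS !mul0r mulr0.
have F1 : F.[1] = lead_coef f.
  rewrite horner_homog big_ord_recr big1/= => [|i _].
    by rewrite subnn expr1n !mulr1 add0r lead_coefE.
  have -> : (d - i = (d - i.+1).+1)%N by have := ltn_ord i; lia.
  by rewrite subrr exprS mul0r !mulr0.
have [Fa Fb] := horner_endpoints_ge0 (ltr01 : 0 < 1 :> R) F01.
move=> x /andP[]; rewrite le_eqVlt => /predU1P[<- _|x0].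
  by rewrite lt_neqAle Fa F0 eq_sym f00.
rewrite le_eqVlt => /predU1P[->|x1]; last by rewrite F01// x0.
by rewrite lt_neqAle Fb F1 eq_sym lead_coef_eq0 fn0.
Qed.

Lemma ler_distM_le1 (R : realDomainType) (a b a' b' : R) :
  0 <= a <= 1 -> 0 <= b' <= 1 ->
  `|a * b - a' * b'| <= `|a - a'| + `|b - b'|.
Proof.
move=> /andP[a0 a1] /andP[b0 b1].
have -> : a * b - a' * b' = (a - a') * b' + a * (b - b') by ring.
apply: (le_trans (ler_normD _ _)); rewrite !normrM (ger0_norm a0) (ger0_norm b0).
by rewrite lerD// ?ler_piMr// ler_piMl.
Qed.

Lemma polya (R : realType) (f : {poly R}) :
  f`_0 != 0 -> (forall x : R, 0 < x -> 0 < f.[x]) ->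
  exists N, forall n, (N <= n)%N -> forall k,
    (k < size (f * (1 + 'X) ^+ n)%R)%N -> 0 < (f * (1 + 'X) ^+ n)`_k.
Proof.
move=> f00 fpos; pose d := (size f).-1.
have fn0 : f != 0 by apply: contra_neq f00 => ->; rewrite coef0.
have sf : size f = d.+1 by rewrite /d prednK// size_poly_gt0.
have [e e0 eF] := continuous_gt0_lbound ler01 (@continuous_horner _ _)
  (homog_gt0 f00 fpos).
(* [B / m] bounds the total error of replacing falling factorials by powers; [N] is chosen to push
   it below the minimum [e] of the homogenization. *)
pose B := \sum_(j < d.+1) `|f`_j| * (j ^ 2 + (d - j) ^ 2)%:R.
have B0 : 0 <= B by apply: sumr_ge0 => j _; rewrite mulr_ge0.
exists (Num.truncn (B / e)).+1 => n Nn k.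
have nX : (1 + 'X : {poly R}) ^+ n != 0.
  by rewrite -size_poly_gt0 size_expr1DX.
rewrite size_mul// sf size_expr1DX => kd.
pose m := (n + d)%N.
have m0 : (0 < m)%N by rewrite /m; lia.
have m0' : 0 < m%:R :> R by rewrite ltr0n.
have km : (k <= m)%N by move: kd; rewrite /m; lia.
have Bem : B / m%:R < e.
  rewrite ltr_pdivrMr// mulrC -ltr_pdivrMr//.
  apply: (lt_le_trans (truncnS_gt _)); rewrite ler_nat.
  by rewrite (leq_trans Nn)// leq_addr.
pose S := \sum_(j < d.+1) f`_j * (k ^_ j * (m - k) ^_ (d - j))%:R.
have SF : `|S / m%:R ^+ d - (homog_poly d f).[k%:R / m%:R]| <= B / m%:R.
  rewrite horner_homog mulr_suml -sumrB mulr_suml.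
  apply: (le_trans (ler_norm_sum _ _ _)); apply: ler_sum => j _.
  have jd : (j <= d)%N by rewrite -ltnS.
  rewrite -[_ * _ / _]mulrA -mulrBr normrM -mulrA ler_wpM2l//.
  have -> : 1 - k%:R / m%:R = (m - k)%:R / m%:R :> R.
    by rewrite natrB// mulrBl divff// gt_eqF.
  have -> : m%:R ^+ d = m%:R ^+ j * m%:R ^+ (d - j) :> R.
    by rewrite -exprD subnKC.
  rewrite natrM -mulf_div.
  rewrite natrD mulrDl; apply: (le_trans (ler_distM_le1 _ _ _ _)).
  - by rewrite ffact_expr_le1.
  - rewrite exprn_ge0 ?exprn_ile1// ?divr_ge0// ler_pdivrMr//.
    by rewrite mul1r ler_nat leq_subr.
  - by rewrite lerD// ffact_expr_dist// leq_subr.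
have S0 : 0 < S.
  have kF : e <= (homog_poly d f).[k%:R / m%:R].
    by apply: eF; rewrite divr_ge0// ler_pdivrMr// mul1r ler_nat.
  have : 0 < S / m%:R ^+ d.
    by move: SF; rewrite ler_norml => /andP[]; lra.
  by rewrite pmulr_lgt0// invr_gt0 exprn_gt0.
have fact0 i : 0 < i`!%:R :> R by rewrite ltr0n fact_gt0.
have := @coefM_expr1DX R f n d k; rewrite sf => /(_ (leqnn _) km) cE.
have : 0 < n`!%:R * S by rewrite mulr_gt0.
by rewrite -cE pmulr_lgt0// natrM mulr_gt0.
Qed.

(** * Power series division by a polynomial with nonnegative coefficients *)

Lemma poly_dominated (R : realFieldType) (f e : {poly R}) :
  0 < f`_0 -> (forall k, 0 <= f`_k) -> exists h, forall k, e`_k <= (f * h)`_k.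
Proof.
move=> f0 fge0; elim/poly_ind: e => [|e c [h eh]].
  by exists 0 => k; rewrite mulr0.
(* The added constant settles coefficient 0 and only increases the higher ones, since [f] has
   nonnegative coefficients. *)
exists (h * 'X + (`|c| / f`_0)%:P) => k.
rewrite mulrDr mulrA !coefD !coefMX coefMC coefC.
case: k => [|k]/=; last first.
  by rewrite addr0 (le_trans (eh k))// lerDl mulr_ge0// divr_ge0// ltW.
by rewrite !add0r mulrC divfK ?gt_eqF// ler_norm.
Qed.

(* If f * h = 1 + X^L e with e >= 0 then g * h agrees with the power series
   g / f below degree L; so the hypothesis says that g / f has nonnegative
   coefficients, and since f_0 > 0 these vanish beyond the degree of g. *)
Lemma dominated_multipliers_proportional (R : realFieldType) (f g : {poly R}) :
  0 < f`_0 -> (forall k, 0 <= f`_k) -> (size g <= size f)%N ->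
  (forall h, (forall k, 0 <= (f * h)`_k) -> forall k, 0 <= (g * h)`_k) ->
  exists c, g = c *: f.
Proof.
move=> f0 fge0 sgf fg.
have f0' : f`_0 != 0 by rewrite gt_eqF.
have fn0 : f != 0 by apply: contra_neq f0' => ->; rewrite coef0.
pose w := - (f`_0)^-1 *: drop_poly 1 f; pose y := 'X * w.
have fE : f = f`_0 *: (1 - y).
  apply/polyP => k; rewrite /y /w coefZ coefB coef1 coefXM coefZ coef_drop_poly.
  case: k => [|k]/=; first by rewrite subr0 mulr1.
  by rewrite addn1 sub0r mulNr opprK mulVKf.
(* Twice the size suffices: the quotient [l] will have size at most [size f], so [f * l] has no
   coefficient at [L] or beyond. *)
pose L := (size f).*2.
pose s := (f`_0)^-1 *: \sum_(i < L) y ^+ i.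
have fs : f * s = 1 - y ^+ L.
  rewrite fE /s -scalerAr -scalerAl scalerA mulVf// scale1r.
  by apply: oppr_inj; rewrite opprB -mulNr opprB subrX1.
have [k kE] := poly_dominated (w ^+ L) f0 fge0.
have fh : f * (s + 'X^L * k) = 1 + 'X^L * (f * k - w ^+ L).
  by rewrite mulrDr fs /y exprMn; ring.
have fh_ge0 i : 0 <= (f * (s + 'X^L * k))`_i.
  rewrite fh coefD coefXnM coef1 addr_ge0//.
  by case: ltnP => // iL; rewrite coefB subr_ge0.
have gs_ge0 n : (n < L)%N -> 0 <= (g * s)`_n.
  move=> nL; have := fg _ fh_ge0 n.
  by rewrite mulrDr [g * ('X^L * _)]mulrCA coefD coefXnM nL addr0.
have fgs n : (n < L)%N -> (f * (g * s))`_n = g`_n.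
  move=> nL; rewrite mulrCA fs mulrBr mulr1 coefB exprMn mulrCA coefXnM nL.
  by rewrite subr0.
have gs0 n : (size f <= n < L)%N -> (g * s)`_n = 0.
  move=> /andP[fn nL]; apply: le_anti; rewrite gs_ge0// andbT.
  rewrite -(pmulr_rle0 _ f0).
  suff : f`_0 * (g * s)`_n <= g`_n.
    by rewrite [g`_n]nth_default// (leq_trans sgf).
  rewrite -fgs// [leRHS]coefM big_ord_recl/= subn0 lerDl sumr_ge0// => i _.
  by rewrite mulr_ge0// gs_ge0// (leq_ltn_trans (leq_subr _ _)).
pose l := take_poly (size f) (g * s).
have lgs n : (n < L)%N -> l`_n = (g * s)`_n.
  by move=> nL; rewrite coef_take_poly; case: ltnP => // fn; rewrite gs0// fn.
have gE : g = f * l.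
  apply/polyP => n; have [nL|Ln] := ltnP n L.
    rewrite -fgs// !coefM; apply: eq_bigr => i _.
    by rewrite lgs// (leq_ltn_trans (leq_subr _ _)).
  rewrite !nth_default//.
    rewrite (leq_trans (size_polyMleq _ _))//.
    have := size_take_poly (size f) (g * s); rewrite -/l.
    by move: Ln; rewrite /L; lia.
  by rewrite (leq_trans sgf)// (leq_trans _ Ln)// /L -addnn leq_addr.
have /size1_polyC lC : (size l <= 1)%N.
  have [->|ln0] := eqVneq l 0; first by rewrite size_poly0.
  move: sgf; rewrite gE size_mul//.
  have : (0 < size f)%N by rewrite size_poly_gt0.
  by move: (size f) (size l) => a b; lia.
by exists l`_0; rewrite gE {1}lC mulrC mul_polyC.
Qed.

(** * Continuity of coefficients and transfer from a dense set of multipliers *)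

Lemma coef_poly_top_continuous (R : realType) (k : nat) :
  continuous (fun q : poly_top R => (q : {poly R})`_k).
Proof.
move=> p.
apply: (@continuous_comp _ _ _ (@deg_coefs R : poly_top R -> _)
  (fun x => x.2 k)); first exact: initial_continuous.
apply: (@continuous_comp _ _ _ (@snd nat {ptws nat -> R}) (fun x => x k)).
  exact: cvg_snd.
exact: (@proj_continuous _ (fun=> R) k).
Qed.

Lemma near_deg_poly_top (R : realType) (p : poly_top R) :
  \forall q \near p, deg (q : {poly R}) = deg (p : {poly R}).
Proof.
have : {for p, continuous (fun q : poly_top R => deg (q : {poly R}))}.
  apply: (@continuous_comp _ _ _ (@deg_coefs R : poly_top R -> _) fst).
    exact: initial_continuous.
  exact: cvg_fst.
move=> /(_ [set deg (p : {poly R})]); apply.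
exact: (discrete_set1 (deg (p : {poly R}))).
Qed.

Lemma coefM_poly_top_continuous (R : realType) (f : {poly R}) (k : nat) :
  continuous (fun q : poly_top R => (f * (q : {poly R}))`_k).
Proof.
under eq_fun do rewrite coefM.
apply: continuous_big => [|j _ p]; first exact: add_continuous.
apply: (continuous_comp (@coef_poly_top_continuous R (k - j) p)).
exact: mulrl_continuous.
Qed.

Lemma dense_in_calM_nbhs (R : realType) (M : set {poly R}) (p : {poly R})
    (U : set {poly R}) :
  dense_in_calM M -> calM p -> nbhs (p : poly_top R) U ->
  exists2 q, M q & calM q /\ U q.
Proof.
move=> Md pM; rewrite nbhsE => -[B [oB Bp] BU].
have [||q [Bq Mq]] := Md (set_val @^-1` B).
- by exists (SigSub (mem_set pM : p \in (@calM R : set (poly_top R)))).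
- by exists B.
by exists (set_val q) => //; split; [exact: set_valP|exact: BU].
Qed.

Lemma horner_gt0 (R : numDomainType) (p : {poly R}) (x : R) : p != 0 -> 0 < x ->
  (forall k, (k < size p)%N -> 0 < p`_k) -> 0 < p.[x].
Proof.
move=> pn0 x0 p_gt0; rewrite horner_coef.
have : (0 < size p)%N by rewrite size_poly_gt0.
case E: (size p) => [//|n] _; rewrite E in p_gt0.
rewrite big_ord_recl/= ltr_pwDl ?mulr_gt0 ?exprn_gt0 ?p_gt0//.
by rewrite sumr_ge0// => i _; rewrite ltW// mulr_gt0 ?exprn_gt0 ?p_gt0// ltnS.
Qed.

Lemma size_deg_eq (R : realType) (p q : {poly R}) :
  p != 0 -> q != 0 -> deg p = deg q -> size p = size q.
Proof.
by rewrite -!size_poly_gt0 /deg => p0 q0 pq; rewrite -(prednK p0) -(prednK q0) pq.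
Qed.

Lemma calM_neq0 (R : realType) (p : {poly R}) : calM p -> p != 0.
Proof.
by move=> [_ p1]; apply: contra_eq_neq p1 => ->; rewrite horner0 eq_sym oner_neq0.
Qed.

(** With the degree locally constant, positivity of the coefficients of [f * q] and negativity of
    one coefficient of [g * q] are open conditions on [q]. A violation at [h], rescaled into [calM],
    would thus occur at some [q] in [M]. *)
Lemma dense_multipliers_gt0 (R : realType) (M : set {poly R}) (f g h : {poly R}) :
  dense_in_calM M -> calM f ->
  (forall q, M q -> (forall k, 0 <= (f * q)`_k) -> forall k, 0 <= (g * q)`_k) ->
  h != 0 -> (forall k, (k < size (f * h)%R)%N -> 0 < (f * h)`_k) ->
  forall k, 0 <= (g * h)`_k.
Proof.
move=> Md fM transfer hn0 fh_gt0 k; have fn0 := calM_neq0 fM.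
have h_gt0 x : 0 < x -> 0 < h.[x].
  move=> x0; rewrite -(pmulr_rgt0 _ (fM.1 x x0)) -hornerM.
  by rewrite horner_gt0 ?mulf_neq0.
have h1 := h_gt0 1 ltr01; pose p := h.[1]^-1 *: h.
have pM : calM p.
  split=> [x x0|]; first by rewrite hornerZ mulr_gt0 ?invr_gt0 ?h_gt0.
  by rewrite hornerZ mulVf// gt_eqF.
have pn0 := calM_neq0 pM.
have fp_gt0 i : (i < size (f * p)%R)%N -> 0 < (f * p)`_i.
  rewrite -scalerAr size_scale ?invr_eq0 ?gt_eqF// => /fh_gt0 fhi.
  by rewrite coefZ mulr_gt0 ?invr_gt0.
rewrite leNgt; apply/negP => gh_lt0.
have [|q Mq [qM [[qp fq] gq]]] := @dense_in_calM_nbhs R M p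
    [set q | (deg q = deg p /\ forall i : 'I_(size (f * p)), 0 < (f * q)`_i) /\
             (g * q)`_k < 0] Md pM.
- have Fp := nbhs_filter (p : poly_top R).
  apply: (@filterI _ _ Fp); first apply: (@filterI _ _ Fp).
  + exact: near_deg_poly_top.
  + apply: (@filter_forall _ _ _ _ Fp) => i.
    apply: (@coefM_poly_top_continuous R f i p [set x | 0 < x]).
    apply: open_nbhs_nbhs; split; first exact: open_gt.
    exact/fp_gt0/ltn_ord.
  + apply: (@coefM_poly_top_continuous R g k p [set x | x < 0]).
    apply: open_nbhs_nbhs; split; first exact: open_lt.
    by rewrite /= -scalerAr coefZ pmulr_rlt0 ?invr_gt0.
- have qn0 := calM_neq0 qM.
  have := transfer q Mq _ k; rewrite leNgt gq => /(_ _)/negP; apply => // i.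
  have [ip|pi] := ltnP i (size (f * p)); first exact: ltW (fq (Ordinal ip)).
  rewrite nth_default// (leq_trans _ pi)// !size_mul//.
  by rewrite (size_deg_eq qn0 pn0 qp).
Qed.

Lemma dense_multipliers_ge0 (R : realType) (M : set {poly R}) (f g h : {poly R}) :
  dense_in_calM M -> calM f -> f`_0 != 0 ->
  (forall q, M q -> (forall k, 0 <= (f * q)`_k) -> forall k, 0 <= (g * q)`_k) ->
  (forall k, 0 <= (f * h)`_k) -> forall k, 0 <= (g * h)`_k.
Proof.
move=> Md fM f0 transfer fh k; have [N fN] := polya f0 fM.1.
have fn0 := calM_neq0 fM.
(* [n >= N] makes [f * h0] strictly positive; [n >= size h] makes the perturbation [h + e *: h0]
   keep the size of [h0]. *)
pose n := maxn N (size h); pose h0 : {poly R} := (1 + 'X) ^+ n.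
have fh0 := fN n (leq_maxl _ _).
have h0n0 : h0 != 0 by rewrite -size_poly_gt0 size_expr1DX.
have heps e : 0 < e -> 0 <= (g * h)`_k + e * (g * h0)`_k.
  move=> e0; rewrite -coefZ scalerAr -coefD -mulrDr.
  have sh : size (h + e *: h0) = size h0.
    rewrite addrC size_polyDl size_scale ?gt_eqF// size_expr1DX ltnS.
    exact: leq_maxr.
  apply: (dense_multipliers_gt0 Md fM transfer).
    by rewrite -size_poly_gt0 sh size_poly_gt0.
  move=> i ih; rewrite mulrDr coefD -scalerAr coefZ ltr_wpDl// mulr_gt0// fh0//.
  rewrite (leq_trans ih)// !size_mul ?sh//.
  by rewrite -size_poly_gt0 sh size_poly_gt0.
apply/ler_addgt0Pr => e e0; set a := (g * h0)`_k.
have a0 : 0 < `|a| + 1 by rewrite ltr_wpDl.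
apply: (le_trans (heps (e / (`|a| + 1)) _)); first by rewrite divr_gt0.
rewrite lerD2l mulrAC ler_pdivrMr// ler_pM2l//.
by rewrite (le_trans (ler_norm a))// lerDl.
Qed.

Lemma dense_multipliers_eq (R : realType) (M : set {poly R}) (f g : {poly R}) :
  dense_in_calM M -> calM f -> calM g -> deg g = deg f -> f`_0 != 0 ->
  (forall q, M q -> (forall k, 0 <= (f * q)`_k) -> forall k, 0 <= (g * q)`_k) ->
  g = f.
Proof.
move=> Md fM gM gf f0 transfer; have [N fN] := polya f0 fM.1.
have [fn0 gn0] := (calM_neq0 fM, calM_neq0 gM).
pose h0 : {poly R} := (1 + 'X) ^+ N.
have h0n0 : h0 != 0 by rewrite -size_poly_gt0 size_expr1DX.
have fh0 := fN N (leqnn _).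
have [||||c] := @dominated_multipliers_proportional R (f * h0) (g * h0).
- by rewrite fh0// size_poly_gt0 mulf_neq0.
- move=> k; have [/fh0/ltW//|fk] := ltnP k (size (f * h0)).
  by rewrite nth_default.
- by rewrite !size_mul// (size_deg_eq gn0 fn0 gf).
- move=> h; rewrite -!mulrA; exact: dense_multipliers_ge0 Md fM f0 transfer.
(* Cancelling [h0] leaves [g = c *: f]; evaluation at 1 gives [c = 1]. *)
rewrite scalerAl => /(mulIf h0n0) gcf.
have := gM.2; rewrite gcf hornerZ fM.2 mulr1 => ->.
by rewrite scale1r.
Qed.

Theorem proposition1p3 (R : realType) (M M' : set {poly R})
    (Phi : {poly R} -> {poly R})
    (M_sub_M' : M `<=` M')
    (M_semigroup : sub_semigroup M) (M_rich : rich M)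
    (M_dense : dense_in_calM M)
    (M'_semigroup : sub_semigroup M') (M'_rich : rich M')
    (M'_dense : dense_in_calM M')
    (Phi_maps : set_fun M' (@calM R) Phi)
    (Phi_mul : multiplicative_on M' Phi)
    (Phi_deg : degree_preserving_on M' Phi)
    (Phi_pos : forall p : {poly R}, (M' `&` @calP R) p -> calP (Phi p))
    (Phi_id_M : forall p : {poly R}, M p -> Phi p = p) :
  forall p : {poly R}, M' p -> Phi p = p.
Proof.
move=> p; have [n] := ubnP (size p); elim: n p => // n IH p pn M'p.
have [p0|p0] := eqVneq p`_0 0.
  have pE : p = 'X * drop_poly 1 p.
    by apply/polyP => -[|k]; rewrite coefXM// coef_drop_poly addn1.
  have M'q : M' (drop_poly 1 p).
    by apply: (M'_rich.2 1%N); rewrite expr1 -pE.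
  rewrite pE Phi_mul//; last exact: M'_rich.1.
  rewrite Phi_id_M; last exact: M_rich.1.
  have ps := calM_neq0 (M'_semigroup.1 _ M'p).
  rewrite IH// size_drop_poly; move: pn; rewrite -size_poly_gt0 in ps.
  by move: (size p) ps => s; lia.
(* For [q] in [M] with [p * q] coefficientwise nonnegative, [p * q] lies in [calP], hence so does
   [Phi (p * q) = Phi p * q]. *)
apply: (dense_multipliers_eq M_dense (M'_semigroup.1 _ M'p) (Phi_maps p M'p)
  (Phi_deg p M'p) p0) => q Mq pq.
have M'q := M_sub_M' q Mq; have M'pq := M'_semigroup.2 _ _ M'p M'q.
have [+ _] := Phi_pos _ (conj M'pq (conj pq (M'_semigroup.1 _ M'pq).2)).
by rewrite Phi_mul// (Phi_id_M q).
Qed.
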